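(* Consider one time step of the (first-order, one-dimensional) numerical scheme described in the context for the two-phase six-equation model with stiffened gas equations of state, without external heat source, applied to initial data consisting of a single discontinuity between a left constant state (superscript $L$) and a right constant state (superscript $R$), located at a cell face, such that $$u^L=u^R=u>0,\qquad \rho_k^L=\rho_k^R=\rho_k,\qquad e_k^L=e_k^R=e_k\quad(k=1,2),$$ $$\alpha_2^L\ne\alpha_2^R,\qquad T_1=T_2=T,\qquad \gamma_1\ne\gamma_2,$$ with the phases initially also in pressure equilibrium, $p_1=p_2=p$. Let the superscript $*$ denote the solution in the cell immediately downstream of (to the right of) the discontinuity after one time step, where the solution of the temperature relaxation sub-step is any physically admissible solution ($T'>0$, $0<\alpha_2'<1$). Then $$u^*=u,\qquad \rho_k^*=\rho_k,\qquad e_k^*=e_k\quad(k=1,2),\qquad T_1^*=T_2^*=T .$$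
   Context: Notation. For phase $k=1,2$: $\alpha_k\in[0,1]$ volume fraction, $\alpha_1+\alpha_2=1$; $\rho_k>0$ density; $e_k$ specific internal energy; $p_k>0$ pressure; $T_k>0$ temperature. The velocity $u$ is common to both phases, $\rho=\alpha_1\rho_1+\alpha_2\rho_2$, and $\rho E=\sum_k\alpha_k\rho_ke_k+\frac12\rho u^2$. Stiffened gas EOS with constants $\gamma_k>1$, $C_{v,k}>0$, $p_{\infty,k}\ge0$ and $\mathsf{q}_k$ (EOS constant): $$\rho_ke_k=\frac{p_k+\gamma_kp_{\infty,k}}{\gamma_k-1}+\rho_k\mathsf{q}_k,\qquad \rho_ke_k=\rho_kC_{v,k}T_k+p_{\infty,k}+\rho_k\mathsf{q}_k .$$ Write $\Gamma_k=\gamma_k-1$ and $\mathcal{C}_k=\alpha_k\rho_kC_{v,k}$. Scheme. The grid is uniform with cell size $\Delta x$; the time step $\Delta t$ satisfies the usual CFL condition, so that $\xi=u\Delta t/\Delta x\in(0,1)$. One time step consists of the following successive sub-steps. (1) Hyperbolic step. With $\boldsymbol{U}=[\alpha_1\rho_1,\alpha_2\rho_2,\rho u,\alpha_1\rho_1e_1,\alpha_2\rho_2e_2,\rho E,\alpha_2]^T$, $\boldsymbol{F}(\boldsymbol{U})=u\boldsymbol{U}+(\alpha_1p_1+\alpha_2p_2)[0,0,1,0,0,u,0]^T$, $\boldsymbol{R}(\boldsymbol{U})=[0,0,0,\alpha_1p_1,\alpha_2p_2,0,-\alpha_2]^T$, $$\boldsymbol{U}_i^{n+1}=\boldsymbol{U}_i^n-\frac{\Delta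 t}{\Delta x}\left[\boldsymbol{F}(\boldsymbol{U}^*_{i+1/2})-\boldsymbol{F}(\boldsymbol{U}^*_{i-1/2})\right]-\frac{\Delta t}{\Delta x}\boldsymbol{R}(\boldsymbol{U}_i^n)\left(u^*_{i+1/2}-u^*_{i-1/2}\right),$$ where $\boldsymbol{U}^*_{i+1/2}$ is the face value given by the HLLC approximate Riemann solver for the states $\boldsymbol{U}_i,\boldsymbol{U}_{i+1}$. This solver resolves isolated contact discontinuities exactly: for two states with equal velocity $u>0$ and equal pressure, it returns the left state. (2) Viscous step. A conservative central-difference discretization of $\partial_t(\rho u)=\partial_x(\frac43\mu\,\partial_xu)$ is used, together with the corresponding viscous work in the energies; $\alpha_k$ and $\alpha_k\rho_k$ are frozen. All viscous fluxes are proportional to discrete differences of $u$, so the step does nothing when $u$ is uniform. (3) Pressure relaxation step. The phase pressures are driven instantaneously to a common value by $\partial_t(\alpha_k\rho_k)=0$, $\partial_t(\rho u)=0$, $\partial_t(\alpha_k\rho_ke_k)=-p_I\mathcal{F}_k$, $\partial_t\alpha_k=\mathcal{F}_k$, with $\mathcal{F}_k=\eta(p_k-p_{k^*})$, where $k^*$ is the other phase, $\eta\to\infty$, and $p_I$ is a convex combination of $p_1,p_2$. The common pressure and the phase energies are then recomputed from $\rho E$ and the relaxed volume fractions. The step does nothing if $p_1=p_2$. (4) Temperature relaxation step (in cells containing both phases). With $\alpha_k\rho_k$ and $u$ frozen, given values $T_1^0,T_2^0,\alpha_2^0$ before the step, find the common temperature $T'$ and volume fraction $\alpha_2'$ such that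 $$\mathcal{C}_2(T'-T_2^0)+\mathcal{B}_2(\alpha_2'-\alpha_2^0)=0,\qquad \mathcal{B}_2\mathcal{C}_1(T'-T_1^0)+(\mathcal{B}_1+\mathcal{B}_2)\mathcal{C}_2(T'-T_2^0)=0,$$ where $\mathcal{B}_1=p_{\infty,1}-p_{\infty,2}$ and $$\mathcal{B}_2=\mathcal{B}_2(T_1,T_2,\alpha_2)=\frac{\Gamma_1\mathcal{C}_1T_1/\alpha_1^2+\Gamma_1p_{\infty,1}/\alpha_1+\Gamma_2\mathcal{C}_2T_2/\alpha_2^2+\Gamma_2p_{\infty,2}/\alpha_2}{\Gamma_1/\alpha_1+\Gamma_2/\alpha_2}+p_{\infty,2}$$ is evaluated at the averages $T_k=(T_k^0+T')/2$, $\alpha_2=(\alpha_2^0+\alpha_2')/2$, $\alpha_1=1-\alpha_2$. The new phase densities are $\rho_k'=(\alpha_k\rho_k)/\alpha_k'$, and the new phase energies follow from the EOS. (5) Heat conduction step. With $\alpha_k\rho_k$ and $u$ frozen and $T_1=T_2=T$, solve $\partial_tT=\mathcal{V}_1q_1+\mathcal{V}_2q_2$, $\partial_t\alpha_2=\mathcal{U}_1q_1+\mathcal{U}_2q_2$, with coefficients $\mathcal{V}_k,\mathcal{U}_k$ depending on $T,\alpha_2$. Here $q_k$ is the central-difference discretization of $\partial_x(\alpha_k\lambda_k\partial_xT)$, which vanishes when $T$ is spatially uniform. *)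

(* Defs.v *)
(* Stdlib reals, with Coquelicot for derivatives and limits. *)
From Stdlib Require Import Reals ZArith.
From Coquelicot Require Import Coquelicot.
Open Scope R_scope.

Inductive phase : Type := P1 | P2.

Definition other (k : phase) : phase := match k with P1 => P2 | P2 => P1 end.

Definition sum2 (f : phase -> R) : R := f P1 + f P2.

Record stiffened_gas : Type := StiffenedGas {
  gam : R;
  Cv : R;
  pinf : R;
  qf : R        (* additive constant of the internal energy *)
}.

Definition Gam (g : stiffened_gas) : R := gam g - 1.

(* The two equations of state are
     rho e = (p + gam pinf) / (gam - 1) + rho qf,
     rho e = rho Cv T + pinf + rho qf;
   they are used solved for p and for T. *)
Definition eos_pressure (g : stiffened_gas) (rho e : R) : R :=
  Gam g * (rho * e - rho * qf g) - gam g * pinf g.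
Definition eos_temperature (g : stiffened_gas) (rho e : R) : R :=
  (rho * e - pinf g - rho * qf g) / (rho * Cv g).

(* Vectors of R^7, ordered as
   [alpha1 rho1, alpha2 rho2, rho u, alpha1 rho1 e1, alpha2 rho2 e2, rho E, alpha2]. *)
Record state : Type := State {
  m1 : R; m2 : R; mom : R; en1 : R; en2 : R; etot : R; a2 : R
}.

Definition vadd (U V : state) : state :=
  State (m1 U + m1 V) (m2 U + m2 V) (mom U + mom V) (en1 U + en1 V)
        (en2 U + en2 V) (etot U + etot V) (a2 U + a2 V).
Definition vscale (c : R) (U : state) : state :=
  State (c * m1 U) (c * m2 U) (c * mom U) (c * en1 U)
        (c * en2 U) (c * etot U) (c * a2 U).
Definition vsub (U V : state) : state := vadd U (vscale (-1) V).

Definition vf (k : phase) (U : state) : R :=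
  match k with P1 => 1 - a2 U | P2 => a2 U end.
Definition mass (k : phase) (U : state) : R :=
  match k with P1 => m1 U | P2 => m2 U end.
Definition en (k : phase) (U : state) : R :=
  match k with P1 => en1 U | P2 => en2 U end.

Definition mixture_density (U : state) : R := sum2 (fun k => mass k U).
Definition velocity (U : state) : R := mom U / mixture_density U.
Definition kinetic (U : state) : R :=
  / 2 * mixture_density U * (velocity U) ^ 2.

(* Phase quantities below are meaningful only where phase k is present
   (vf k U > 0).  In the flux the phase pressures always come multiplied by
   their volume fraction, so an absent phase contributes 0. *)
Definition density (k : phase) (U : state) : R := mass k U / vf k U.
Definition energy (k : phase) (U : state) : R := en k U / mass k U.

Definition fluids : Type := phase -> stiffened_gas.

Definition pressure (G : fluids) (k : phase) (U : state) : R :=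
  eos_pressure (G k) (density k U) (energy k U).
Definition temperature (G : fluids) (k : phase) (U : state) : R :=
  eos_temperature (G k) (density k U) (energy k U).

Definition has_both_phases (U : state) : Prop := 0 < a2 U < 1.

Definition physical (G : fluids) (U : state) : Prop :=
  0 <= a2 U <= 1 /\
  (forall k, 0 < vf k U ->
     0 < mass k U /\ 0 < pressure G k U /\ 0 < temperature G k U) /\
  (forall k, vf k U = 0 -> mass k U = 0 /\ en k U = 0) /\
  etot U = sum2 (fun k => en k U) + kinetic U.

(* The vector U of a cell with volume fraction al of phase 2, phase densities
   rho, phase specific energies e and velocity u. *)
Definition state_of (al : R) (rho e : phase -> R) (u : R) : state :=
  let r1 := (1 - al) * rho P1 in
  let r2 := al * rho P2 in
  State r1 r2 ((r1 + r2) * u) (r1 * e P1) (r2 * e P2)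
        (r1 * e P1 + r2 * e P2 + / 2 * (r1 + r2) * u ^ 2) al.

(* The cell with the partial densities and the momentum of U, volume fraction
   al of phase 2 and common temperature T; the energies follow from the
   equation of state in the form
     alpha_k rho_k e_k = alpha_k rho_k Cv T + alpha_k pinf + alpha_k rho_k qf. *)
Definition isothermal_state (G : fluids) (U : state) (al T : R) : state :=
  let E1 := m1 U * Cv (G P1) * T + (1 - al) * pinf (G P1) + m1 U * qf (G P1) in
  let E2 := m2 U * Cv (G P2) * T + al * pinf (G P2) + m2 U * qf (G P2) in
  State (m1 U) (m2 U) (mom U) E1 E2 (E1 + E2 + kinetic U) al.

(* Data of the scheme.  Face functions take the states of the left and of the
   right neighbouring cell. *)
Record scheme : Type := Scheme {
  dx : R;
  dt : R;
  (* face value U*_{i+1/2} of the approximate Riemann solver *)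
  hllc : state -> state -> state;
  (* face value of the viscosity mu *)
  mu_face : state -> state -> R;
  (* fraction of the viscous dissipation of a cell received by each phase *)
  visc_share : phase -> state -> R;
  (* face value of alpha_k lambda_k *)
  cond_face : phase -> state -> state -> R;
  (* coefficients V_k and U_k of the heat conduction step, as functions of the
     (frozen) partial densities, of T and of alpha_2 *)
  calV : phase -> (phase -> R) -> R -> R -> R;
  calU : phase -> (phase -> R) -> R -> R -> R
}.

Definition grid : Type := Z -> state.

Definition at_pressure (G : fluids) (U : state) (p : R) : Prop :=
  forall k, 0 < vf k U -> pressure G k U = p.

Definition resolves_contacts (G : fluids)
    (riemann : state -> state -> state) : Prop :=
  forall (UL UR : state) (u p : R),
    physical G UL -> physical G UR ->
    0 < u -> velocity UL = u -> velocity UR = u ->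
    at_pressure G UL p -> at_pressure G UR p ->
    riemann UL UR = UL.

Definition mixture_pressure (G : fluids) (U : state) : R :=
  sum2 (fun k => vf k U * pressure G k U).

Definition flux (G : fluids) (U : state) : state :=
  vadd (vscale (velocity U) U)
       (vscale (mixture_pressure G U) (State 0 0 1 0 0 (velocity U) 0)).

Definition nonconservative (G : fluids) (U : state) : state :=
  State 0 0 0 (vf P1 U * pressure G P1 U) (vf P2 U * pressure G P2 U) 0 (- a2 U).

Definition hyperbolic_step (G : fluids) (S : scheme) (U U' : grid) : Prop :=
  forall i : Z,
    let Up := hllc S (U i) (U (i + 1)%Z) in
    let Um := hllc S (U (i - 1)%Z) (U i) in
    U' i =
      vsub (vsub (U i) (vscale (dt S / dx S) (vsub (flux G Up) (flux G Um))))
           (vscale (dt S / dx S)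
              (vscale (velocity Up - velocity Um) (nonconservative G (U i)))).

(* At face i+1/2: discrete derivative of u, viscous stress, and flux of viscous
   work. *)
Definition face_strain (S : scheme) (U : grid) (i : Z) : R :=
  (velocity (U (i + 1)%Z) - velocity (U i)) / dx S.
Definition face_stress (S : scheme) (U : grid) (i : Z) : R :=
  4 / 3 * mu_face S (U i) (U (i + 1)%Z) * face_strain S U i.
Definition face_work (S : scheme) (U : grid) (i : Z) : R :=
  face_stress S U i * ((velocity (U i) + velocity (U (i + 1)%Z)) / 2).

(* The dissipation of a cell is the mean of stress * strain over its two faces:
   this is what the flux of viscous work leaves for the internal energy once
   the work u * (stress difference) / dx has been subtracted. *)
Definition dissipation (S : scheme) (U : grid) (i : Z) : R :=
  (face_stress S U i * face_strain S U i
   + face_stress S U (i - 1) * face_strain S U (i - 1)) / 2.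

Definition viscous_step (S : scheme) (U U' : grid) : Prop :=
  forall i : Z,
    a2 (U' i) = a2 (U i) /\
    (forall k, mass k (U' i) = mass k (U i)) /\
    mom (U' i) =
      mom (U i) + dt S / dx S * (face_stress S U i - face_stress S U (i - 1)) /\
    (forall k, en k (U' i) =
      en k (U i) + dt S * (visc_share S k (U i) * dissipation S U i)) /\
    etot (U' i) =
      etot (U i) + dt S / dx S * (face_work S U i - face_work S U (i - 1)).

(* [W eta t] solves the pressure relaxation system with parameter eta, from the
   state U; [theta] gives the weights of the interface pressure p_I. *)
Definition pressure_relaxation_flow (G : fluids) (U : state)
    (W : R -> R -> state) (theta : R -> R -> R) : Prop :=
  forall eta : R, 0 < eta ->
    W eta 0 = U /\
    forall t : R, 0 <= t ->
      let p k := pressure G k (W eta t) in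
      let F k := eta * (p k - p (other k)) in
      let pI := theta eta t * p P1 + (1 - theta eta t) * p P2 in
      has_both_phases (W eta t) /\
      0 <= theta eta t <= 1 /\
      (forall k, 0 < p k) /\
      (forall k, mass k (W eta t) = mass k U) /\
      mom (W eta t) = mom U /\
      (forall k, is_derive (fun s => en k (W eta s)) t (- pI * F k)) /\
      (forall k, is_derive (fun s => vf k (W eta s)) t (F k)).

(* Instantaneous relaxation: at every positive time the volume fraction reaches
   the relaxed value al as eta -> +infinity. *)
Definition relaxed_volume_fraction (G : fluids) (U : state) (al : R) : Prop :=
  exists (W : R -> R -> state) (theta : R -> R -> R),
    pressure_relaxation_flow G U W theta /\
    forall t : R, 0 < t -> is_lim (fun eta => a2 (W eta t)) p_infty al.

(* In a pure cell there is nothing to relax, but its energy is still recomputed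
   from rho E. *)
Definition pressure_relaxation_step (G : fluids) (U U' : grid) : Prop :=
  forall i : Z,
    (has_both_phases (U i) -> relaxed_volume_fraction G (U i) (a2 (U' i))) /\
    (~ has_both_phases (U i) -> a2 (U' i) = a2 (U i)) /\
    (forall k, mass k (U' i) = mass k (U i)) /\
    mom (U' i) = mom (U i) /\
    etot (U' i) = etot (U i) /\
    exists p : R,
      (forall k, en k (U' i) =
         vf k (U' i) * ((p + gam (G k) * pinf (G k)) / Gam (G k))
         + mass k (U' i) * qf (G k)) /\
      sum2 (fun k => en k (U' i)) + kinetic (U' i) = etot (U i).

Definition calC (G : fluids) (U : state) (k : phase) : R := mass k U * Cv (G k).

Definition calB1 (G : fluids) : R := pinf (G P1) - pinf (G P2).

Definition calB2 (G : fluids) (C : phase -> R) (T1 T2 al2 : R) : R :=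
  let al1 := 1 - al2 in
  let G1 := Gam (G P1) in
  let G2 := Gam (G P2) in
  (G1 * C P1 * T1 / al1 ^ 2 + G1 * pinf (G P1) / al1
   + G2 * C P2 * T2 / al2 ^ 2 + G2 * pinf (G P2) / al2)
  / (G1 / al1 + G2 / al2)
  + pinf (G P2).

(* T and al are a physically admissible solution of the temperature relaxation
   problem for the cell U. *)
Definition temperature_relaxation_solution (G : fluids) (U : state)
    (T al : R) : Prop :=
  let T1 := temperature G P1 U in
  let T2 := temperature G P2 U in
  let C := calC G U in
  let B1 := calB1 G in
  let B2 := calB2 G C ((T1 + T) / 2) ((T2 + T) / 2) ((a2 U + al) / 2) in
  0 < T /\ 0 < al < 1 /\
  C P2 * (T - T2) + B2 * (al - a2 U) = 0 /\
  B2 * C P1 * (T - T1) + (B1 + B2) * C P2 * (T - T2) = 0.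

Definition temperature_relaxation_step (G : fluids) (U U' : grid) : Prop :=
  forall i : Z,
    (has_both_phases (U i) ->
       exists T al : R,
         temperature_relaxation_solution G (U i) T al /\
         U' i = isothermal_state G (U i) al T) /\
    (~ has_both_phases (U i) -> U' i = U i).

(* Temp is the field of the common temperatures of the phases present. *)
Definition common_temperature (G : fluids) (U : grid) (Temp : Z -> R) : Prop :=
  forall (i : Z) (k : phase), 0 < vf k (U i) -> temperature G k (U i) = Temp i.

Definition heat_flux (S : scheme) (U : grid) (Temp : Z -> R)
    (k : phase) (i : Z) : R :=
  cond_face S k (U i) (U (i + 1)%Z) * ((Temp (i + 1)%Z - Temp i) / dx S).

(* q_k in cell i *)
Definition heat_source (S : scheme) (U : grid) (Temp : Z -> R)
    (k : phase) (i : Z) : R :=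
  (heat_flux S U Temp k i - heat_flux S U Temp k (i - 1)) / dx S.

(* The q_k are computed from the temperatures at the beginning of the step. *)
Definition heat_conduction_step (G : fluids) (S : scheme) (U U' : grid) : Prop :=
  exists Temp : Z -> R,
    common_temperature G U Temp /\
    forall i : Z,
      let q k := heat_source S U Temp k i in
      let m k := mass k (U i) in
      exists T al : R -> R,
        T 0 = Temp i /\ al 0 = a2 (U i) /\
        (forall t : R, 0 <= t <= dt S ->
           is_derive T t (sum2 (fun k => calV S k m (T t) (al t) * q k)) /\
           is_derive al t (sum2 (fun k => calU S k m (T t) (al t) * q k))) /\
        U' i = isothermal_state G (U i) (al (dt S)) (T (dt S)).

Definition time_step (G : fluids) (S : scheme) (U U' : grid) : Prop :=
  exists Uh Uv Up Ut : grid,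
    hyperbolic_step G S U Uh /\
    viscous_step S Uh Uv /\
    pressure_relaxation_step G Uv Up /\
    temperature_relaxation_step G Up Ut /\
    heat_conduction_step G S Ut U'.

(* Main.v *)
Require Import Defs.
From Stdlib Require Import Reals ZArith Lra Lia.
From Coquelicot Require Import Coquelicot.
Open Scope R_scope.

(** The data form a contact discontinuity: on both sides the fluids have the
    same velocity, densities, energies, pressure and temperature, and only the
    volume fraction of phase 2 jumps.  For fixed rho, e and u the vector
    [state_of al rho e u] is affine in al, and every sub-step keeps the grid
    inside this one-parameter family ([mixture_grid]).

    The Riemann solver returns upwind values, all with velocity u and mixture
    pressure p, so the flux difference is u times the difference of the states:
    the hyperbolic step is the upwind scheme for the volume fraction and
    changes nothing else ([hyperbolic_step_mixture]).  In the downstream cell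
    the result is a convex combination, with weight strictly between 0 and 1,
    of two distinct fractions of [0,1]: both phases are present there, which
    makes the phase densities and energies recoverable from the conserved
    vector.

    The other four steps leave such a grid unchanged.
    - Viscosity acts through differences of the uniform velocity.
    - Under pressure relaxation the pressure difference D satisfies D' = - K D
      with K >= 0, so it stays 0 and the volume fractions do not move
      ([relaxation_of_equal_pressures]); the total energy then determines the
      recomputed common pressure, because sum_k alpha_k / Gamma_k > 0.
    - The two equations of temperature relaxation, with equal initial
      temperatures, form a homogeneous triangular system for T' - T and
      alpha_2' - alpha_2.  Its diagonal entries B2 C1 + (B1 + B2) C2 and B2 are
      positive at every admissible point, so, although B2 itself depends on the
      unknowns, the only solution is the trivial one
      ([temperature_relaxation_unique]).
    - Heat conduction has zero sources, since every cell has temperature T. *)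

(** * Two facts about scalar differential equations *)

Lemma constant_of_zero_derivative (f : R -> R) (b : R) :
  0 <= b -> (forall t, 0 <= t <= b -> is_derive f t 0) -> f b = f 0.
Proof.
  intros Hb Hd.
  destruct (MVT_gen f 0 b (fun _ => 0)) as [c [_ Hc]].
  - intros x. rewrite Rmin_left, Rmax_right by assumption.
    intros Hx. apply Hd. lra.
  - intros x. rewrite Rmin_left, Rmax_right by assumption.
    intros Hx. apply derivable_continuous_pt.
    exists 0. apply is_derive_Reals, Hd, Hx.
  - lra.
Qed.

(** The square of D cannot increase, its derivative being - 2 K D^2: the
    argument uses K through its sign alone. *)
Lemma damped_from_zero (D K : R -> R) :
  D 0 = 0 ->
  (forall t, 0 <= t -> 0 <= K t /\ is_derive D t (- K t * D t)) ->
  forall t, 0 <= t -> D t = 0.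
Proof.
  intros H0 Hd t Ht.
  assert (Hsq : forall x, 0 <= x ->
            is_derive (fun s => D s * D s) x (- 2 * K x * (D x * D x))).
  { intros x Hx. destruct (Hd x Hx) as [_ HD].
    auto_derive.
    - repeat split; eexists; exact HD.
    - replace (Derive (fun s : R => D s) x) with (- K x * D x)
        by (symmetry; apply is_derive_unique, HD).
      ring. }
  destruct (MVT_gen (fun s => D s * D s) 0 t
              (fun x => - 2 * K x * (D x * D x))) as [c [Hc Heq]].
  - intros x. rewrite Rmin_left, Rmax_right by assumption.
    intros Hx. apply Hsq. lra.
  - intros x. rewrite Rmin_left, Rmax_right by assumption.
    intros Hx. apply derivable_continuous_pt.
    eexists. apply is_derive_Reals, Hsq. lra.
  - rewrite Rmin_left, Rmax_right in Hc by assumption.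
    rewrite H0 in Heq.
    destruct (Hd c (proj1 Hc)) as [HK _].
    assert (0 <= K c * (D c * D c) * t)
      by (apply Rmult_le_pos; [apply Rmult_le_pos; [lra | apply Rle_0_sqr] | lra]).
    assert (D t * D t <= 0) by nra.
    nra.
Qed.

(** * Mixtures of the two equilibrium fluids *)

Record equilibrium (G : fluids) (rho e : phase -> R) (p T : R) : Prop :=
  Equilibrium {
    eq_gam : forall k, 1 < gam (G k);
    eq_Cv : forall k, 0 < Cv (G k);
    eq_pinf : forall k, 0 <= pinf (G k);
    eq_rho : forall k, 0 < rho k;
    eq_p : 0 < p;
    eq_T : 0 < T;
    eq_pressure : forall k, eos_pressure (G k) (rho k) (e k) = p;
    eq_temperature : forall k, eos_temperature (G k) (rho k) (e k) = T
  }.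

Lemma state_eq (V W : state) :
  a2 V = a2 W -> mom V = mom W -> etot V = etot W ->
  (forall k, mass k V = mass k W) -> (forall k, en k V = en k W) -> V = W.
Proof.
  intros Ha Hm Ht Hk He.
  pose proof (Hk P1) as H1; pose proof (Hk P2) as H2.
  pose proof (He P1) as H3; pose proof (He P2) as H4.
  destruct V, W; simpl in *; congruence.
Qed.

Lemma mass_state_of al rho e u k :
  mass k (state_of al rho e u) = vf k (state_of al rho e u) * rho k.
Proof. destruct k; reflexivity. Qed.

Lemma en_state_of al rho e u k :
  en k (state_of al rho e u) = vf k (state_of al rho e u) * (rho k * e k).
Proof. destruct k; simpl; ring. Qed.

Lemma density_state_of al rho e u k :
  vf k (state_of al rho e u) <> 0 -> density k (state_of al rho e u) = rho k.
Proof. intros H. unfold density. rewrite mass_state_of. field. exact H. Qed.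

Lemma energy_state_of al rho e u k :
  vf k (state_of al rho e u) <> 0 -> rho k <> 0 ->
  energy k (state_of al rho e u) = e k.
Proof.
  intros H Hr. unfold energy. rewrite mass_state_of, en_state_of.
  field. split; assumption.
Qed.

Lemma velocity_state_of al rho e u :
  (forall k, 0 < rho k) -> 0 <= al <= 1 -> velocity (state_of al rho e u) = u.
Proof.
  intros Hr Ha. unfold velocity, mixture_density, sum2. simpl.
  pose proof (Hr P1). pose proof (Hr P2).
  field. nra.
Qed.

Lemma kinetic_state_of al rho e u :
  (forall k, 0 < rho k) -> 0 <= al <= 1 ->
  kinetic (state_of al rho e u)
  = / 2 * ((1 - al) * rho P1 + al * rho P2) * u ^ 2.
Proof.
  intros Hr Ha. unfold kinetic. rewrite velocity_state_of by assumption.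
  reflexivity.
Qed.

Lemma etot_state_of al rho e u :
  (forall k, 0 < rho k) -> 0 <= al <= 1 ->
  etot (state_of al rho e u)
  = sum2 (fun k => en k (state_of al rho e u)) + kinetic (state_of al rho e u).
Proof.
  intros Hr Ha. rewrite kinetic_state_of by assumption. reflexivity.
Qed.

Lemma vf_pos V k : has_both_phases V -> 0 < vf k V.
Proof. unfold has_both_phases; destruct k; simpl; lra. Qed.

Lemma has_both_phases_dec V : {has_both_phases V} + {~ has_both_phases V}.
Proof.
  unfold has_both_phases.
  destruct (Rlt_dec 0 (a2 V)), (Rlt_dec (a2 V) 1); [left | right ..]; lra.
Qed.

Lemma pressure_state_of G rho e p T al u k :
  equilibrium G rho e p T -> vf k (state_of al rho e u) <> 0 ->
  pressure G k (state_of al rho e u) = p.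
Proof.
  intros E H. unfold pressure.
  pose proof (eq_rho _ _ _ _ _ E k).
  rewrite density_state_of, energy_state_of by (assumption || lra).
  apply (eq_pressure _ _ _ _ _ E).
Qed.

Lemma temperature_state_of G rho e p T al u k :
  equilibrium G rho e p T -> vf k (state_of al rho e u) <> 0 ->
  temperature G k (state_of al rho e u) = T.
Proof.
  intros E H. unfold temperature.
  pose proof (eq_rho _ _ _ _ _ E k).
  rewrite density_state_of, energy_state_of by (assumption || lra).
  apply (eq_temperature _ _ _ _ _ E).
Qed.

(** The two equations of state solved for the energy, the form in which the
    relaxation and conduction steps recompute it. *)
Lemma energy_of_pressure G rho e p T k :
  equilibrium G rho e p T ->
  rho k * e k = (p + gam (G k) * pinf (G k)) / Gam (G k) + rho k * qf (G k).
Proof.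
  intros E. rewrite <- (eq_pressure _ _ _ _ _ E k).
  pose proof (eq_gam _ _ _ _ _ E k).
  unfold eos_pressure, Gam. field. lra.
Qed.

Lemma energy_of_temperature G rho e p T k :
  equilibrium G rho e p T ->
  rho k * e k = rho k * Cv (G k) * T + pinf (G k) + rho k * qf (G k).
Proof.
  intros E. rewrite <- (eq_temperature _ _ _ _ _ E k).
  pose proof (eq_rho _ _ _ _ _ E k). pose proof (eq_Cv _ _ _ _ _ E k).
  unfold eos_temperature. field. lra.
Qed.

(** Temperature relaxation and heat conduction rebuild a cell from its
    temperature and volume fraction; a cell that already has temperature T is
    rebuilt as it was. *)
Lemma isothermal_state_of G rho e p T al u :
  equilibrium G rho e p T -> 0 <= al <= 1 ->
  isothermal_state G (state_of al rho e u) al T = state_of al rho e u.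
Proof.
  intros E Ha.
  pose proof (energy_of_temperature _ _ _ _ _ P1 E) as H1.
  pose proof (energy_of_temperature _ _ _ _ _ P2 E) as H2.
  unfold isothermal_state.
  rewrite kinetic_state_of by (exact (eq_rho _ _ _ _ _ E) || assumption).
  unfold state_of; simpl.
  rewrite (Rmult_assoc (1 - al) (rho P1) (e P1)), H1,
    (Rmult_assoc al (rho P2) (e P2)), H2.
  f_equal; ring.
Qed.

Lemma physical_state_of G rho e p T al u :
  equilibrium G rho e p T -> 0 <= al <= 1 -> physical G (state_of al rho e u).
Proof.
  intros E Ha. repeat split.
  - apply Ha.
  - apply Ha.
  - rewrite mass_state_of. apply Rmult_lt_0_compat; [assumption|].
    apply (eq_rho _ _ _ _ _ E).
  - rewrite (pressure_state_of G rho e p T) by (assumption || lra).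
    apply (eq_p _ _ _ _ _ E).
  - rewrite (temperature_state_of G rho e p T) by (assumption || lra).
    apply (eq_T _ _ _ _ _ E).
  - rewrite mass_state_of, H. ring.
  - rewrite en_state_of, H. ring.
  - apply etot_state_of; [apply (eq_rho _ _ _ _ _ E) | assumption].
Qed.

(** The mixture pressure is p in pure cells too: there the meaningless pressure
    of the absent phase is multiplied by 0. *)
Lemma flux_state_of G rho e p T al u :
  equilibrium G rho e p T -> 0 <= al <= 1 ->
  flux G (state_of al rho e u)
  = vadd (vscale u (state_of al rho e u)) (vscale p (State 0 0 1 0 0 u 0)).
Proof.
  intros E Ha. unfold flux.
  rewrite velocity_state_of by (exact (eq_rho _ _ _ _ _ E) || assumption).
  replace (mixture_pressure G (state_of al rho e u)) with p; [reflexivity|].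
  assert (H : forall k, vf k (state_of al rho e u) * pressure G k (state_of al rho e u)
               = vf k (state_of al rho e u) * p).
  { intros k. destruct (Req_dec (vf k (state_of al rho e u)) 0) as [H0|H0].
    - rewrite H0; ring.
    - rewrite (pressure_state_of G rho e p T) by assumption. reflexivity. }
  unfold mixture_pressure, sum2. rewrite !H. simpl. ring.
Qed.

(** The invariant of the time step.  The closed bounds on A admit pure cells,
    where [state_of] still makes sense but density and energy do not. *)
Definition mixture_grid (rho e : phase -> R) (u : R) (A : Z -> R) (U : grid) : Prop :=
  forall i, 0 <= A i <= 1 /\ U i = state_of (A i) rho e u.

(** * The five sub-steps on a grid of mixtures *)

(** All face values have velocity u, so the nonconservative term vanishes, and
    the pressure parts of the two fluxes cancel.  What remains is affine in the
    volume fraction. *)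
Lemma hyperbolic_step_mixture G S rho e p T u A U U' :
  equilibrium G rho e p T -> 0 < u -> 0 < u * dt S / dx S < 1 ->
  resolves_contacts G (hllc S) ->
  mixture_grid rho e u A U -> hyperbolic_step G S U U' ->
  mixture_grid rho e u
    (fun i => A i - u * dt S / dx S * (A i - A (i - 1)%Z)) U'.
Proof.
  intros E Hu Hxi Hllc HU Hstep i.
  assert (Hr := eq_rho _ _ _ _ _ E).
  destruct (HU i) as [Hi Ui], (HU (i - 1)%Z) as [Hm Um], (HU (i + 1)%Z) as [Hp Up].
  split.
  (* A convex combination of A i and A (i - 1), by the CFL condition. *)
  { set (xi := u * dt S / dx S) in *. nra. }
  assert (Hface : forall al be, 0 <= al <= 1 -> 0 <= be <= 1 ->
            hllc S (state_of al rho e u) (state_of be rho e u)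
            = state_of al rho e u).
  { intros al be Hal Hbe.
    apply (Hllc _ _ u p); try assumption.
    - eapply physical_state_of; eassumption.
    - eapply physical_state_of; eassumption.
    - apply velocity_state_of; assumption.
    - apply velocity_state_of; assumption.
    - intros k Hk. apply (pressure_state_of G rho e p T); [assumption | lra].
    - intros k Hk. apply (pressure_state_of G rho e p T); [assumption | lra]. }
  rewrite (Hstep i), Ui, Um, Up, !Hface by assumption.
  rewrite !(flux_state_of G rho e p T) by assumption.
  rewrite !velocity_state_of by assumption.
  replace (u * dt S / dx S) with (dt S / dx S * u) by (unfold Rdiv; ring).
  generalize (nonconservative G (state_of (A i) rho e u)) (dt S / dx S).
  generalize (A i) (A (i - 1)%Z). clear. intros a b N c.
  apply state_eq; [| | | intros [|] | intros [|]]; cbn; ring.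
Qed.

Lemma viscous_step_mixture S rho e u A U U' :
  (forall k, 0 < rho k) ->
  mixture_grid rho e u A U -> viscous_step S U U' -> mixture_grid rho e u A U'.
Proof.
  intros Hr HU Hstep i.
  split; [apply HU|]. rewrite <- (proj2 (HU i)).
  assert (Hv : forall l, velocity (U l) = u).
  { intros l. destruct (HU l) as [Hl ->]. apply velocity_state_of; assumption. }
  assert (Hstrain : forall l, face_strain S U l = 0).
  { intros l. unfold face_strain. rewrite !Hv. unfold Rdiv; ring. }
  assert (Hstress : forall l, face_stress S U l = 0).
  { intros l. unfold face_stress. rewrite Hstrain. ring. }
  assert (Hdiss : dissipation S U i = 0).
  { unfold dissipation. rewrite !Hstress. unfold Rdiv; ring. }
  destruct (Hstep i) as (Ha & Hm & Hmom & Hen & Het).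
  unfold face_work in Het. rewrite !Hstress in *.
  apply state_eq.
  - exact Ha.
  - rewrite Hmom. ring.
  - rewrite Het. ring.
  - exact Hm.
  - intros k. rewrite Hen, Hdiss. ring.
Qed.

Lemma pressure_formula G k V :
  mass k V <> 0 -> vf k V <> 0 ->
  pressure G k V
  = Gam (G k) * ((en k V - mass k V * qf (G k)) / vf k V) - gam (G k) * pinf (G k).
Proof.
  intros Hm Hv. unfold pressure, eos_pressure, density, energy.
  field. split; assumption.
Qed.

(** The rate of change of a phase pressure when the phase has constant mass m,
    its volume fraction grows at rate F and it does the work pI F.  For pI = p
    the bracket is gam (p + pinf), that is rho c^2 with c the speed of sound. *)
Lemma is_derive_stiffened_pressure (g : stiffened_gas) (en al : R -> R)
    (m t pI F : R) :
  al t <> 0 -> is_derive en t (- pI * F) -> is_derive al t F ->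
  let P s := Gam g * ((en s - m * qf g) / al s) - gam g * pinf g in
  is_derive P t (- F / al t * (Gam g * pI + P t + gam g * pinf g)).
Proof.
  intros Ha He Hal P. unfold P. auto_derive.
  - repeat split; try assumption; eexists; eassumption.
  - replace (Derive (fun s : R => en s) t) with (- pI * F)
      by (symmetry; apply is_derive_unique, He).
    replace (Derive (fun s : R => al s) t) with F
      by (symmetry; apply is_derive_unique, Hal).
    field. exact Ha.
Qed.

(** Since F_1 = eta D = - F_2 for D = p_1 - p_2, subtracting the two pressure
    equations gives D' = - K D with K a sum of nonnegative compressibility
    terms.  Hence D = 0 and both F_k vanish, for every eta and not only in the
    limit. *)
Lemma relaxation_of_equal_pressures G U W theta eta t :
  (forall k, 1 < gam (G k)) -> (forall k, 0 <= pinf (G k)) ->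
  (forall k, 0 < mass k U) -> pressure G P1 U = pressure G P2 U ->
  pressure_relaxation_flow G U W theta -> 0 < eta -> 0 <= t ->
  a2 (W eta t) = a2 U.
Proof.
  intros Hg Hpi Hm Heq Hflow Heta Ht.
  destruct (Hflow eta Heta) as [HW0 HW].
  (* The pressure with the mass frozen at its initial value.  It equals the
     pressure along the flow for s >= 0, but the flow keeps the mass only for
     s >= 0 whereas the derivative at s = 0 is two-sided. *)
  set (P := fun k s => Gam (G k) * ((en k (W eta s) - mass k U * qf (G k))
                          / vf k (W eta s)) - gam (G k) * pinf (G k)).
  set (pI := fun s => theta eta s * pressure G P1 (W eta s)
                      + (1 - theta eta s) * pressure G P2 (W eta s)).
  set (K := fun s => eta *
         ((Gam (G P1) * pI s + P P1 s + gam (G P1) * pinf (G P1)) / vf P1 (W eta s)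
          + (Gam (G P2) * pI s + P P2 s + gam (G P2) * pinf (G P2)) / vf P2 (W eta s))).
  assert (HP : forall k s, 0 <= s -> pressure G k (W eta s) = P k s).
  { intros k s Hs. destruct (HW s Hs) as (Hb & _ & _ & Hmass & _).
    pose proof (Hm k). pose proof (vf_pos _ k Hb).
    rewrite pressure_formula by (rewrite ?Hmass; lra).
    rewrite Hmass. reflexivity. }
  assert (HD : forall s, 0 <= s -> P P1 s - P P2 s = 0).
  { apply (damped_from_zero (fun s => P P1 s - P P2 s) K).
    - rewrite <- !HP by lra. rewrite HW0. lra.
    - intros s Hs. destruct (HW s Hs) as (Hb & Hth & Hpos & _ & _ & Hen & Hvf).
      pose proof (vf_pos _ P1 Hb) as Hv1. pose proof (vf_pos _ P2 Hb) as Hv2.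
      split.
      + assert (HpI : 0 <= pI s).
        { unfold pI. pose proof (Hpos P1); pose proof (Hpos P2). simpl in *. nra. }
        assert (Hk : forall k, 0 <= (Gam (G k) * pI s + P k s
                   + gam (G k) * pinf (G k)) / vf k (W eta s)).
        { intros k. pose proof (vf_pos _ k Hb). pose proof (Hg k).
          pose proof (Hpi k). pose proof (Hpos k) as Hpk. simpl in Hpk.
          rewrite HP in Hpk by assumption.
          apply Rmult_le_pos; [| left; apply Rinv_0_lt_compat; assumption].
          unfold Gam. nra. }
        unfold K. pose proof (Hk P1). pose proof (Hk P2).
        apply Rmult_le_pos; lra.
      + pose proof (is_derive_stiffened_pressure (G P1) _ _ (mass P1 U) s _ _
                      (Rgt_not_eq _ _ Hv1) (Hen P1) (Hvf P1)) as H1.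
        pose proof (is_derive_stiffened_pressure (G P2) _ _ (mass P2 U) s _ _
                      (Rgt_not_eq _ _ Hv2) (Hen P2) (Hvf P2)) as H2.
        pose proof (is_derive_minus _ _ _ _ _ H1 H2) as H12.
        match type of H12 with is_derive _ _ ?l =>
          replace (- K s * (P P1 s - P P2 s)) with l end; [exact H12|].
        unfold minus, plus, opp, K, pI; simpl. rewrite !(HP _ s) by assumption.
        unfold P; simpl. field.
        split; apply Rgt_not_eq; assumption. }
  transitivity (a2 (W eta 0)); [| rewrite HW0; reflexivity].
  apply (constant_of_zero_derivative (fun s => a2 (W eta s))); [assumption|].
  intros s [Hs _]. destruct (HW s Hs) as (_ & _ & _ & _ & _ & _ & Hvf).
  pose proof (Hvf P2) as H. simpl in H. rewrite !HP in H by assumption.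
  replace 0 with (eta * (P P2 s - P P1 s)); [exact H|].
  pose proof (HD s Hs). nra.
Qed.

(** The volume fraction is kept, so the recomputed energies depend only on the
    common pressure q; the total energy is affine in q with slope
    sum_k alpha_k / Gamma_k > 0, and q = p reproduces it. *)
Lemma pressure_relaxation_step_mixture G rho e p T u A U U' :
  equilibrium G rho e p T ->
  mixture_grid rho e u A U -> pressure_relaxation_step G U U' ->
  mixture_grid rho e u A U'.
Proof.
  intros E HU Hstep i. destruct (HU i) as [HA Ui]. split; [exact HA|].
  assert (Hr := eq_rho _ _ _ _ _ E).
  destruct (Hstep i) as (Hboth & Hpure & Hm & Hmom & Het & q & Hen & Hsum).
  rewrite Ui in *. set (V := state_of (A i) rho e u) in *.
  assert (Ha : a2 (U' i) = a2 V).
  { destruct (has_both_phases_dec V) as [Hb|Hn]; [| exact (Hpure Hn)].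
    destruct (Hboth Hb) as (W & theta & Hflow & Hlim).
    specialize (Hlim 1 Rlt_0_1).
    assert (Hc : is_lim (fun eta => a2 (W eta 1)) p_infty (a2 V)).
    { apply is_lim_ext_loc with (fun _ => a2 V).
      - exists 0. intros eta Heta. symmetry.
        apply (relaxation_of_equal_pressures G V W theta); try lra.
        + apply (eq_gam _ _ _ _ _ E).
        + apply (eq_pinf _ _ _ _ _ E).
        + intros k. unfold V. rewrite mass_state_of.
          apply Rmult_lt_0_compat; [apply vf_pos; exact Hb | apply Hr].
        + pose proof (vf_pos _ P1 Hb). pose proof (vf_pos _ P2 Hb).
          unfold V. rewrite !(pressure_state_of G rho e p T) by
            (assumption || (fold V; lra)).
          reflexivity.
        + exact Hflow.
      - apply is_lim_const. }
    apply is_lim_unique in Hlim. apply is_lim_unique in Hc.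
    rewrite Hlim in Hc. injection Hc as Hc. exact Hc. }
  assert (Hvf : forall k, vf k (U' i) = vf k V)
    by (intros [|]; simpl; rewrite Ha; reflexivity).
  assert (Hkin : kinetic (U' i) = kinetic V).
  { unfold kinetic, velocity, mixture_density, sum2.
    rewrite Hmom, !Hm. reflexivity. }
  assert (HenV : forall k, en k V =
            vf k V * ((p + gam (G k) * pinf (G k)) / Gam (G k))
            + mass k V * qf (G k)).
  { intros k. unfold V. rewrite en_state_of, mass_state_of.
    rewrite (energy_of_pressure G rho e p T) by assumption. ring. }
  assert (Hq : q = p).
  { unfold V in Hsum. rewrite etot_state_of in Hsum by assumption.
    fold V in Hsum. rewrite Hkin in Hsum. unfold sum2 in Hsum.
    rewrite !Hen, !HenV, !Hvf, !Hm in Hsum.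
    pose proof (eq_gam _ _ _ _ _ E P1). pose proof (eq_gam _ _ _ _ _ E P2).
    assert (0 < / Gam (G P1)) by (apply Rinv_0_lt_compat; unfold Gam; lra).
    assert (0 < / Gam (G P2)) by (apply Rinv_0_lt_compat; unfold Gam; lra).
    unfold Rdiv in Hsum.
    assert (Hc : (q - p) * (vf P1 V * / Gam (G P1) + vf P2 V * / Gam (G P2)) = 0)
      by lra.
    apply Rmult_integral in Hc. destruct Hc as [Hc|Hc]; [lra|].
    simpl in Hc. exfalso. nra. }
  subst q. apply state_eq; try assumption.
  intros k. rewrite Hen, HenV, Hvf, Hm. reflexivity.
Qed.

(** The fraction in B2 is a weighted interface pressure, positive because the
    temperatures are; adding pinf of phase 2 gives B2, and adding pinf of phase
    1 gives B1 + B2. *)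
Lemma calB2_pos G C T1 T2 al :
  (forall k, 1 < gam (G k)) -> (forall k, 0 <= pinf (G k)) ->
  (forall k, 0 < C k) -> 0 < T1 -> 0 < T2 -> 0 < al < 1 ->
  0 < calB2 G C T1 T2 al /\ 0 < calB1 G + calB2 G C T1 T2 al.
Proof.
  intros Hg Hpi HC HT1 HT2 Hal.
  pose proof (Hpi P1). pose proof (Hpi P2).
  assert (Hw : forall k x T, 0 < x -> 0 < T -> 0 < Gam (G k) / x
      /\ 0 < Gam (G k) * C k * T / x ^ 2 /\ 0 <= Gam (G k) * pinf (G k) / x).
  { intros k x T Hx HT. pose proof (Hg k). pose proof (Hpi k). pose proof (HC k).
    assert (0 < Gam (G k)) by (unfold Gam; lra).
    repeat split.
    - apply Rdiv_lt_0_compat; assumption.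
    - apply Rdiv_lt_0_compat; [| apply pow_lt; assumption].
      repeat apply Rmult_lt_0_compat; assumption.
    - apply Rmult_le_pos; [nra | left; apply Rinv_0_lt_compat; assumption]. }
  destruct (Hw P1 (1 - al) T1) as (? & ? & ?); [lra | lra |].
  destruct (Hw P2 al T2) as (? & ? & ?); [lra | lra |].
  unfold calB1, calB2. cbv zeta.
  match goal with |- context [?n / ?d + _] => assert (0 < n / d) end.
  { apply Rdiv_lt_0_compat; lra. }
  split; lra.
Qed.

(** B2 is positive at the averages of the old and new values whatever the
    solution is, since temperatures and volume fractions stay in the admissible
    range under averaging.  The second equation then forces T' = T, after which
    the first forces the volume fraction. *)
Lemma temperature_relaxation_unique G V T T' al' :
  (forall k, 1 < gam (G k)) -> (forall k, 0 < Cv (G k)) ->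
  (forall k, 0 <= pinf (G k)) -> (forall k, 0 < mass k V) ->
  has_both_phases V -> 0 < T -> (forall k, temperature G k V = T) ->
  temperature_relaxation_solution G V T' al' -> T' = T /\ al' = a2 V.
Proof.
  intros Hg HCv Hpi Hm Hb HT Htemp (HT' & Hal' & H1 & H2).
  rewrite !Htemp in *. unfold has_both_phases in Hb.
  assert (HC : forall k, 0 < calC G V k)
    by (intros k; apply Rmult_lt_0_compat; auto).
  destruct (calB2_pos G (calC G V) ((T + T') / 2) ((T + T') / 2)
              ((a2 V + al') / 2)) as [HB2 HB12]; try assumption; try lra.
  set (B2 := calB2 G (calC G V) ((T + T') / 2) ((T + T') / 2)
               ((a2 V + al') / 2)) in *.
  pose proof (HC P1) as HC1. pose proof (HC P2) as HC2.
  assert (HTT : T' = T).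
  { assert (Hz : (B2 * calC G V P1 + (calB1 G + B2) * calC G V P2) * (T' - T) = 0)
      by lra.
    apply Rmult_integral in Hz. destruct Hz as [Hz|Hz]; [| lra].
    pose proof (Rmult_lt_0_compat _ _ HB2 HC1).
    pose proof (Rmult_lt_0_compat _ _ HB12 HC2). lra. }
  split; [exact HTT|].
  rewrite HTT in H1.
  assert (Hz : B2 * (al' - a2 V) = 0) by lra.
  apply Rmult_integral in Hz. lra.
Qed.

Lemma temperature_relaxation_step_mixture G rho e p T u A U U' :
  equilibrium G rho e p T ->
  mixture_grid rho e u A U -> temperature_relaxation_step G U U' ->
  mixture_grid rho e u A U'.
Proof.
  intros E HU Hstep i. destruct (HU i) as [HA Ui]. split; [exact HA|].
  destruct (Hstep i) as [Hboth Hpure]. rewrite Ui in *.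
  destruct (has_both_phases_dec (state_of (A i) rho e u)) as [Hb|Hn];
    [| exact (Hpure Hn)].
  destruct (Hboth Hb) as (T' & al' & Hsol & ->).
  apply (temperature_relaxation_unique G _ T) in Hsol; try assumption.
  - destruct Hsol as [-> ->]. apply (isothermal_state_of G rho e p T); assumption.
  - apply (eq_gam _ _ _ _ _ E).
  - apply (eq_Cv _ _ _ _ _ E).
  - apply (eq_pinf _ _ _ _ _ E).
  - intros k. rewrite mass_state_of.
    apply Rmult_lt_0_compat; [apply vf_pos; exact Hb | apply (eq_rho _ _ _ _ _ E)].
  - apply (eq_T _ _ _ _ _ E).
  - intros k. apply (temperature_state_of G rho e p T); [assumption|].
    pose proof (vf_pos _ k Hb). lra.
Qed.

Lemma heat_conduction_step_mixture G S rho e p T u A U U' :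
  equilibrium G rho e p T -> 0 < dt S ->
  mixture_grid rho e u A U -> heat_conduction_step G S U U' ->
  mixture_grid rho e u A U'.
Proof.
  intros E Hdt HU (Temp & Hcommon & Hstep) i.
  destruct (HU i) as [HA Ui]. split; [exact HA|].
  assert (HTemp : forall l, Temp l = T).
  { intros l. destruct (HU l) as [Hl Ul].
    assert (Hk : exists k, 0 < vf k (U l)).
    { rewrite Ul. destruct (Rlt_dec 0 (A l)); [exists P2 | exists P1]; simpl; lra. }
    destruct Hk as [k Hk]. rewrite <- (Hcommon l k Hk). rewrite Ul in *.
    apply (temperature_state_of G rho e p T); [assumption | lra]. }
  assert (Hq : forall k, heat_source S U Temp k i = 0).
  { intros k. unfold heat_source, heat_flux. rewrite !HTemp. unfold Rdiv. ring. }
  destruct (Hstep i) as (T' & al' & HT0 & Hal0 & Hder & ->).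
  assert (HT : T' (dt S) = T).
  { rewrite <- (HTemp i), <- HT0.
    apply constant_of_zero_derivative; [lra|]. intros t Ht.
    destruct (Hder t Ht) as [Hd _]. unfold sum2 in Hd. rewrite !Hq in Hd.
    rewrite !Rmult_0_r, Rplus_0_r in Hd. exact Hd. }
  assert (Hal : al' (dt S) = A i).
  { transitivity (al' 0); [| rewrite Hal0, Ui; reflexivity].
    apply constant_of_zero_derivative; [lra|]. intros t Ht.
    destruct (Hder t Ht) as [_ Hd]. unfold sum2 in Hd. rewrite !Hq in Hd.
    rewrite !Rmult_0_r, Rplus_0_r in Hd. exact Hd. }
  rewrite HT, Hal, Ui. apply (isothermal_state_of G rho e p T); assumption.
Qed.

(** * The time step *)

Theorem proposition2 (G : fluids) (S : scheme)
  (rho e : phase -> R) (u p T aL aR : R) (j : Z) (U U' : grid)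
  (hgam : forall k, 1 < gam (G k))
  (hCv : forall k, 0 < Cv (G k))
  (hpinf : forall k, 0 <= pinf (G k))
  (hdx : 0 < dx S) (hdt : 0 < dt S)
  (hCFL : 0 < u * dt S / dx S < 1)
  (hhllc : resolves_contacts G (hllc S))
  (hu : 0 < u)
  (hrho : forall k, 0 < rho k)
  (hp : 0 < p) (hT : 0 < T)
  (haL : 0 <= aL <= 1) (haR : 0 <= aR <= 1) (haLR : aL <> aR)
  (hpres : forall k, eos_pressure (G k) (rho k) (e k) = p)
  (htemp : forall k, eos_temperature (G k) (rho k) (e k) = T)
  (hgam12 : gam (G P1) <> gam (G P2))
  (hleft : forall i, (i <= j)%Z -> U i = state_of aL rho e u)
  (hright : forall i, (j < i)%Z -> U i = state_of aR rho e u)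
  (hstep : time_step G S U U') :
  let Us := U' (j + 1)%Z in
  velocity Us = u /\
  (forall k, density k Us = rho k) /\
  (forall k, energy k Us = e k) /\
  (forall k, temperature G k Us = T).
Proof.
  assert (E : equilibrium G rho e p T) by (constructor; assumption).
  destruct hstep as (Uh & Uv & Up & Ut & Hh & Hv & Hpr & Ht & Hc).
  set (A := fun i => if Z_le_dec i j then aL else aR).
  assert (H0 : mixture_grid rho e u A U).
  { intros i. unfold A. destruct (Z_le_dec i j); split; auto.
    apply hright. lia. }
  apply (hyperbolic_step_mixture _ _ _ _ _ _ _ _ _ _ E hu hCFL hhllc H0) in Hh.
  apply (viscous_step_mixture _ _ _ _ _ _ _ hrho Hh) in Hv.
  apply (pressure_relaxation_step_mixture _ _ _ _ _ _ _ _ _ E Hv) in Hpr.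
  apply (temperature_relaxation_step_mixture _ _ _ _ _ _ _ _ _ E Hpr) in Ht.
  apply (heat_conduction_step_mixture _ _ _ _ _ _ _ _ _ _ E hdt Ht) in Hc.
  destruct (Hc (j + 1)%Z) as [Hal HU]. cbv zeta. rewrite HU.
  set (xi := u * dt S / dx S) in *.
  set (al := A (j + 1)%Z - _) in *.
  assert (Hmix : 0 < al < 1).
  { unfold al, A. destruct (Z_le_dec (j + 1) j) as [?|_]; [lia|].
    destruct (Z_le_dec (j + 1 - 1) j) as [_|?]; [| lia].
    destruct (Rdichotomy _ _ haLR); nra. }
  assert (Hvf : forall k, vf k (state_of al rho e u) <> 0)
    by (intros [|]; simpl; lra).
  repeat split.
  - apply velocity_state_of; assumption.
  - intros k. apply density_state_of. apply Hvf.
  - intros k. pose proof (hrho k). apply energy_state_of; [apply Hvf | lra].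
  - intros k. apply (temperature_state_of G rho e p T); [assumption | apply Hvf].
Qed.
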